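(* Let $\mathcal{TPA}=\mathcal{LT}/\langle\alpha\rangle$ be the ternary partially associative operad with one generating operation $t$ of even (homological) degree, over a field of characteristic $0$, where $\alpha=t\circ_1 t+t\circ_2 t+t\circ_3 t$. For every weight $k\ge 3$ we have $$\dim \mathcal{TPA}(2k+1)=k+1.$$
   Context: A ternary tree is a rooted plane tree in which every node has either no children (a leaf) or exactly $3$ children (an internal node). The weight of a tree is its number $w$ of internal nodes; its arity is its number $1+2w$ of leaves, which are indexed from left to right. The basic tree $t$ is the ternary tree of weight $1$. For trees $p,q$ and $i$ at most the arity of $p$, the partial composition $p\circ_i q$ is the tree obtained by identifying leaf $i$ of $p$ with the root of $q$. For odd $n\ge1$, $\mathcal{LT}(n)$ is the vector space over a field of characteristic $0$ with basis the ternary trees of arity $n$, and $\mathcal{LT}=\bigoplus_n\mathcal{LT}(n)$ with partial compositions extended bilinearly; this is the free nonsymmetric operad on one ternary operation $t$ of even degree (no Koszul signs occur). The ideal $\langle\alpha\rangle$ is the smallest homogeneous (i.e. direct sum of arity components) subspace $\mathcal{S}$ of $\mathcal{LT}$ containing $\alpha$ such that $f\in\mathcal{S}(m)$, $g\in\mathcal{LT}(n)$ imply $f\circ_i g,\ g\circ_j f\in\mathcal{S}$ for all $1\le i\le m$, $1\le j\le n$. $\mathcal{TPA}(n)=\mathcal{LT}(n)/\langle\alpha\rangle(n)$ is the arity $n$ component of the quotient operad. *)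

(* Defs.v *)
From HB Require Import structures.
From mathcomp Require Import all_boot all_algebra.
From mathcomp Require Import boolp zify.

Set Implicit Arguments.
Unset Strict Implicit.
Unset Printing Implicit Defensive.

Import GRing.Theory.
Local Open Scope ring_scope.

Inductive tree := Leaf | Node of tree & tree & tree.

Fixpoint weight (p : tree) : nat :=
  if p is Node a b c then (weight a + weight b + weight c).+1 else 0.

Fixpoint arity (p : tree) : nat :=
  if p is Node a b c then (arity a + arity b + arity c)%N else 1.

Lemma arity_weight p : arity p = (1 + 2 * weight p)%N.
Proof.
by elim: p => //= a -> b -> c ->; lia.
Qed.

Lemma arity_gt0 p : (0 < arity p)%N.
Proof. by rewrite arity_weight. Qed.

(* Leaves are numbered from left to right starting at 0, so that
   [graft p i q] is the tree usually written p o_(i+1) q.  It is only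
   meaningful for [i < arity p]. *)
Fixpoint graft (p : tree) (i : nat) (q : tree) : tree :=
  if p is Node a b c then
    if (i < arity a)%N then Node (graft a i q) b c
    else if (i < arity a + arity b)%N then Node a (graft b (i - arity a) q) c
    else Node a b (graft c (i - (arity a + arity b)) q)
  else q.

Lemma arity_graft p i q :
  (i < arity p)%N -> arity (graft p i q) = (arity p + arity q).-1.
Proof.
have q0 := arity_gt0 q.
elim: p i => [|a IHa b IHb c IHc] i //= ltip.
case: ltnP => [lti|lei] /=; first by rewrite IHa //; lia.
case: ltnP => [lti|lei'] /=; first by rewrite IHb; lia.
by rewrite IHc; lia.
Qed.

Fixpoint tree_encode (p : tree) : GenTree.tree unit :=
  if p is Node a b c
  then GenTree.Node 1 [:: tree_encode a; tree_encode b; tree_encode c]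
  else GenTree.Node 0 [::].

Fixpoint tree_decode (p : GenTree.tree unit) : option tree :=
  match p with
  | GenTree.Node 0 [::] => Some Leaf
  | GenTree.Node 1 [:: a; b; c] =>
      match tree_decode a, tree_decode b, tree_decode c with
      | Some a', Some b', Some c' => Some (Node a' b' c')
      | _, _, _ => None
      end
  | _ => None
  end.

Lemma tree_encodeK : pcancel tree_encode tree_decode.
Proof. by elim=> //= a -> b -> c ->. Qed.

HB.instance Definition _ := Countable.copy tree (pcan_type tree_encodeK).

Record ttree (n : nat) : predArgType := TTree { ttval :> tree; _ : arity ttval == n }.

HB.instance Definition _ n := [isSub for @ttval n].
HB.instance Definition _ n := [Countable of ttree n by <:].

Lemma arity_ttree n (p : ttree n) : arity p = n.
Proof. exact/eqP/(valP p). Qed.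

Fixpoint trees_below (h : nat) : seq tree :=
  if h is h'.+1 then
    Leaf :: [seq Node a bc.1 bc.2
               | a <- trees_below h',
                 bc <- [seq (b, c) | b <- trees_below h', c <- trees_below h']]
  else [::].

Lemma mem_trees_below h p : (weight p < h)%N -> p \in trees_below h.
Proof.
elim: h p => // h IHh [|a b c] /=; first by rewrite inE eqxx.
rewrite ltnS => lth; rewrite inE; apply/orP; right.
have Ha : a \in trees_below h.
  by apply/IHh/(leq_trans _ lth); rewrite ltnS -addnA leq_addr.
have Hb : b \in trees_below h.
  by apply/IHh/(leq_trans _ lth); rewrite ltnS addnAC leq_addl.
have Hc : c \in trees_below h.
  by apply/IHh/(leq_trans _ lth); rewrite ltnS leq_addl.
apply/allpairsP; exists (a, (b, c)); split=> //=.
by apply/allpairsP; exists (b, c).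
Qed.

Definition ttree_enum n : seq (ttree n) := pmap insub (undup (trees_below n)).

Lemma ttree_enumP n : Finite.axiom (ttree_enum n).
Proof.
apply: Finite.uniq_enumP => [|p].
  exact/(pmap_sub_uniq _ (undup_uniq _)).
rewrite mem_pmap_sub mem_undup mem_trees_below //.
rewrite -[X in (_ < X)%N](arity_ttree p) arity_weight add1n ltnS.
by rewrite leq_pmull.
Qed.

HB.instance Definition _ n := isFinite.Build (ttree n) (@ttree_enumP n).

Fact tgraft_subproof m n (p : ttree m) (i : 'I_m) (q : ttree n) :
  arity (graft p i q) == (m + n).-1.
Proof. by rewrite arity_graft !arity_ttree. Qed.

Definition tgraft m n (p : ttree m) (i : 'I_m) (q : ttree n) :
  ttree (m + n).-1 := TTree (tgraft_subproof p i q).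

Definition basic_tree : ttree 3 := @TTree 3 (Node Leaf Leaf Leaf) isT.

(* There is no ternary tree of even arity, so [LT F n] is 0 for even [n]. *)
Definition LT (F : fieldType) (n : nat) := {ffun ttree n -> F^o}.

HB.instance Definition _ F n := Vector.on (LT F n).

Section FreeOperad.

Variable F : fieldType.

Definition LTbasis n (p : ttree n) : LT F n := [ffun q => (q == p)%:R].

Definition LTcomp m n (f : LT F m) (i : 'I_m) (g : LT F n) :
    LT F (m + n).-1 :=
  \sum_(p : ttree m) \sum_(q : ttree n) (f p * g q) *: LTbasis (tgraft p i q).

Lemma LTbasisE n (f : LT F n) : f = \sum_p f p *: LTbasis p.
Proof.
apply/ffunP=> q; rewrite sum_ffunE (bigD1 q) //= big1 => [|p /negPf npq].
  by rewrite !ffunE eqxx addr0 [_ *: _]mulr1.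
by rewrite !ffunE eq_sym npq [_ *: _]mulr0.
Qed.

Lemma LTcomp_basis m n (p : ttree m) (i : 'I_m) (q : ttree n) :
  LTcomp (LTbasis p) i (LTbasis q) = LTbasis (tgraft p i q).
Proof.
rewrite /LTcomp (bigD1 p) //= (bigD1 q) //= !big1 => [|p' /negPf np|q' /negPf nq].
- by rewrite !ffunE !eqxx mulr1 scale1r !addr0.
- by rewrite big1 // => q' _; rewrite ffunE np mul0r scale0r.
- by rewrite [LTbasis q q']ffunE nq mulr0 scale0r.
Qed.

(* A homogeneous subspace of LT is a family of subspaces, one per arity. *)
Definition operad_ideal (S : forall n, {vspace LT F n}) : Prop :=
  forall m n (f : LT F m) (g : LT F n), f \in S m ->
    (forall i : 'I_m, LTcomp f i g \in S (m + n).-1) /\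
    (forall j : 'I_n, LTcomp g j f \in S (n + m).-1).

End FreeOperad.

Section Bigcapv.

Variables (F : fieldType) (V : vectType F).

Lemma ex_bigcapv (P : {vspace V} -> Prop) :
  exists W : {vspace V}, forall x, x \in W <-> (forall U, P U -> x \in U).
Proof.
pose Q d := `[< exists2 W : {vspace V},
                  \dim W = d & forall U, P U -> (W <= U)%VS >].
have Q0 : exists d, Q d.
  exists 0%N; apply/asboolP; exists 0%VS; first exact: dimv0.
  by move=> U _; apply: sub0v.
have Qmax d : Q d -> (d <= \dim {:V})%N.
  by case/asboolP=> W <- _; apply/dimvS/subvf.
case: (ex_maxnP Q0 Qmax) => d /asboolP[W dW subW] maxW.
exists W => x; split=> [Wx U PU|Px]; first exact: (subvP (subW U PU)).
have : Q (\dim (W + <[x]>)).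
  apply/asboolP; exists (W + <[x]>)%VS => // U PU.
  by rewrite subv_add subW // -memvE Px.
move/maxW; rewrite -dW => le_dim.
have /eqP-> : W == (W + <[x]>)%VS by rewrite eqEdim addvSl.
exact/(subvP (addvSr _ _))/memv_line.
Qed.

Definition bigcapv (P : {vspace V} -> Prop) : {vspace V} :=
  sval (cid (ex_bigcapv P)).

Lemma bigcapvP (P : {vspace V} -> Prop) x :
  x \in bigcapv P <-> (forall U, P U -> x \in U).
Proof. exact: (svalP (cid (ex_bigcapv P))). Qed.

End Bigcapv.

Section IdealGen.

Variables (F : fieldType) (d : nat) (a : LT F d).

Definition ideal_gen (n : nat) : {vspace LT F n} :=
  bigcapv (fun U => exists S : forall m, {vspace LT F m},
                      [/\ operad_ideal S, a \in S d & U = S n]).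

Lemma ideal_genP n (x : LT F n) :
  x \in ideal_gen n <->
  (forall S : forall m, {vspace LT F m},
     operad_ideal S -> a \in S d -> x \in S n).
Proof.
rewrite bigcapvP; split=> [Ix S idS aS | Ix U [S [idS aS ->]]].
  by apply: Ix; exists S.
exact: Ix.
Qed.

Lemma mem_ideal_gen : a \in ideal_gen d.
Proof. by apply/ideal_genP. Qed.

Lemma ideal_gen_ideal : operad_ideal ideal_gen.
Proof.
move=> m n f g /ideal_genP If; split=> i; apply/ideal_genP=> S idS aS.
  by case: (idS m n f g (If S idS aS)).
by case: (idS m n f g (If S idS aS)).
Qed.

Lemma ideal_gen_min (S : forall m, {vspace LT F m}) :
  operad_ideal S -> a \in S d -> forall n, (ideal_gen n <= S n)%VS.
Proof. by move=> idS aS n; apply/subvP=> x /ideal_genP; apply. Qed.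

End IdealGen.

Section QuotientSpace.

Variables (F : fieldType) (V : vectType F) (U : {vspace V}).

Local Open Scope quotient_scope.

Definition quotv : Type := Quotient.quot (pred_of_vspace U).

HB.instance Definition _ := EqQuotient.on quotv.
HB.instance Definition _ := Choice.on quotv.
HB.instance Definition _ := GRing.Zmodule.on quotv.

Definition piv (x : V) : quotv := \pi_quotv x.

Lemma piv_eq x y : (piv x == piv y) = (x - y \in U).
Proof. by rewrite Quotient.idealrBE. Qed.

Lemma pivD : {morph piv : x y / x + y}.
Proof. by move=> x y; rewrite /piv [LHS]Quotient.pi_add. Qed.

Lemma piv_repr (x : quotv) : piv (repr x) = x.
Proof. exact: reprK. Qed.

Definition quotv_scale (c : F) (x : quotv) : quotv := piv (c *: repr x).

Lemma piv_scale c x : piv (c *: x) = quotv_scale c (piv x).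
Proof.
apply/eqP; rewrite piv_eq -scalerBr memvZ //.
by rewrite -piv_eq piv_repr.
Qed.

Fact quotv_scaleA a b v :
  quotv_scale a (quotv_scale b v) = quotv_scale (a * b) v.
Proof. by rewrite -[v]piv_repr -!piv_scale scalerA. Qed.

Fact quotv_scale1 : left_id 1 quotv_scale.
Proof. by move=> v; rewrite -[v]piv_repr -piv_scale scale1r. Qed.

Fact quotv_scaleDr : right_distributive quotv_scale +%R.
Proof.
move=> a u v; rewrite -[u]piv_repr -[v]piv_repr -pivD -!piv_scale.
by rewrite scalerDr pivD.
Qed.

Fact quotv_scaleDl v : {morph quotv_scale^~ v : a b / a + b}.
Proof.
by move=> a b; rewrite -[v]piv_repr -!piv_scale scalerDl pivD.
Qed.

HB.instance Definition _ := GRing.Zmodule_isLmodule.Build F quotv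
  quotv_scaleA quotv_scale1 quotv_scaleDr quotv_scaleDl.

Fact piv_is_linear : linear piv.
Proof. by move=> c x y; rewrite pivD piv_scale. Qed.

HB.instance Definition _ := GRing.isSemilinear.Build F V quotv _ piv
  (GRing.semilinear_linear piv_is_linear).

(* The quotient is identified with the complement [U^C] chosen by vector.v. *)
Fact quotv_vect_iso : Vector.axiom (\dim U^C) quotv.
Proof.
pose B := vbasis U^C%VS.
pose pC (x : V) := daddv_pi U^C U x.
have dx : (U^C :&: U = 0)%VS by rewrite capvC capv_compl.
have pU x : x \in U -> pC x = 0.
  move=> Ux; have := daddv_pi_add dx (subvP (addvSr U^C U) _ Ux).
  have dx' : (U :&: U^C = 0)%VS by rewrite capv_compl.
  rewrite (daddv_pi_id dx' Ux) -[RHS]add0r; exact: addIr.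
have xU x : x - pC x \in U.
  have xf : x \in (U^C + U)%VS by rewrite addvC addv_complf memvf.
  rewrite -{1}(daddv_pi_add dx xf) addrC addKr; exact: memv_pi.
have pr x : pC (repr (piv x)) = pC x.
  apply/eqP; rewrite -subr_eq0 /pC -linearB; apply/eqP/pU.
  by rewrite -piv_eq piv_repr.
exists (fun w : quotv => \row_i coord B i (pC (repr w))).
  move=> c u v; apply/rowP=> i.
  rewrite -[u]piv_repr -[v]piv_repr -linearP !mxE !pr.
  by rewrite /pC !linearP.
exists (fun r : 'rV_(\dim U^C) => piv (\sum_i r 0 i *: B`_i)) => [w|r].
  rewrite -[w in RHS]piv_repr; apply/eqP; rewrite eq_sym piv_eq.
  have CpC : pC (repr w) \in (U^C)%VS by apply: memv_pi.
  under eq_bigr do rewrite mxE.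
  by rewrite -(coord_vbasis CpC).
apply/rowP=> i; rewrite mxE pr /pC daddv_pi_id //.
  by rewrite coord_sum_free ?(basis_free (vbasisP U^C)).
by apply: rpred_sum => j _; rewrite rpredZ ?vbasis_mem ?memt_nth.
Qed.

HB.instance Definition _ := Lmodule_hasFinDim.Build F quotv quotv_vect_iso.

Lemma dim_quotv : \dim {:quotv} = (\dim {:V} - \dim U)%N.
Proof. by rewrite dimvf -dimv_compl. Qed.

End QuotientSpace.

Section TPA.

Variable F : fieldType.

Definition LTgen : LT F 3 := LTbasis F basic_tree.

(* [(3 + 3).-1] is convertible to 5. *)
Definition alpha : LT F 5 :=
  LTcomp LTgen (inord 0) LTgen + LTcomp LTgen (inord 1) LTgen
  + LTcomp LTgen (inord 2) LTgen.

Lemma alphaE :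
  let Y := Node Leaf Leaf Leaf in
  alpha = LTbasis F (@TTree 5 (Node Y Leaf Leaf) isT)
        + LTbasis F (@TTree 5 (Node Leaf Y Leaf) isT)
        + LTbasis F (@TTree 5 (Node Leaf Leaf Y) isT).
Proof.
rewrite /alpha !LTcomp_basis.
by congr (LTbasis F _ + LTbasis F _ + LTbasis F _); apply: val_inj;
   rewrite /= inordK.
Qed.

Definition TPA (n : nat) := quotv (ideal_gen alpha n).

HB.instance Definition _ n := Vector.on (TPA n).

End TPA.

(* Main.v *)
Require Import Defs.
From HB Require Import structures.
From mathcomp Require Import all_boot all_algebra.
From mathcomp Require Import boolp functions zify ring.

Set Implicit Arguments.
Unset Strict Implicit.
Unset Printing Implicit Defensive.

Import GRing.Theory.
Local Open Scope ring_scope.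

(** Write [abc] for the tree with root subtrees a, b, c, write x for the leaf,
    and let s_0 = x and s_(n+1) = [x s_n x].  The component of weight k >= 3
    of the quotient has as basis the classes of the k trees [x s_i s_j] with
    i + j = k - 1, together with the class of [s_1 s_(k-2) x].

    These trees span.  It suffices that a linear functional that vanishes on
    the ideal and on these trees is zero, and such a functional is handled as
    a function on trees subject to the relation
    f [[abc]de] + f [a[bcd]e] + f [ab[cde]] = 0 in every context.  Over a field
    in which 2 and 3 are invertible this relation has two strong consequences:
    a tree with three internal root subtrees is zero ([internal3_eq0]), and so
    is a tree in which some vertex other than the root has two internal
    children ([branching1_eq0] and its companions).  Below the root only
    caterpillars survive.  With L_1 u = [uxx], L_2 u = [xux], L_3 u = [xxu]
    the relation then reads L_1^2 = L_3^2 = 0, L_1 L_2 = - L_2 L_1,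
    L_2 L_3 = - L_3 L_2 and L_1 L_3 + L_3 L_1 = - L_2^2, so that the
    caterpillars of weight n are spanned by s_n and L_3 s_(n-1)
    ([caterpillar_eq0]).  A few more instances of the relation reduce the trees
    with two internal root subtrees ([fork23_eq0], [fork12_eq0],
    [fork13_eq0]).

    These trees are independent.  An explicit ternary algebra satisfies the
    partial associativity relation ([model_mul_assoc]).  The multilinear
    operations that vanish identically in it form an operad ideal containing
    alpha, hence containing the ideal that alpha generates; evaluating all
    leaves at one generator therefore factors through the quotient, and the
    values of the normal forms are linearly independent
    ([ideal_normal_free]). *)

(** * Trees *)

Inductive context : (tree -> tree) -> Prop :=
| Context_hole : context id
| Context1 K b c : context K -> context (fun p => Node (K p) b c)
| Context2 K a c : context K -> context (fun p => Node a (K p) c)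
| Context3 K a b : context K -> context (fun p => Node a b (K p)).

Definition internal (p : tree) : bool := if p is Leaf then false else true.

Definition branching (p : tree) : bool :=
  if p is Node a b c then (2 <= internal a + internal b + internal c)%N
  else false.

Fixpoint spine (n : nat) : tree :=
  if n is n'.+1 then Node Leaf (spine n') Leaf else Leaf.

Fixpoint mirror (p : tree) : tree :=
  if p is Node a b c then Node (mirror c) (mirror b) (mirror a) else Leaf.

Lemma internalE p : internal p = (0 < weight p)%N.
Proof. by case: p. Qed.

Lemma internalP p : internal p -> exists a b c, p = Node a b c.
Proof. by case: p => // a b c _; exists a, b, c. Qed.

Lemma weight0 p : weight p = 0%N -> p = Leaf.
Proof. by case: p. Qed.

Lemma weight_spine n : weight (spine n) = n.
Proof. by elim: n => //= n ->; rewrite add0n addn0. Qed.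

Lemma mirrorK : involutive mirror.
Proof. by elim=> //= a -> b -> c ->. Qed.

Lemma weight_mirror p : weight (mirror p) = weight p.
Proof. by elim: p => //= a -> b -> c ->; lia. Qed.

Lemma internal_mirror p : internal (mirror p) = internal p.
Proof. by case: p. Qed.

Lemma branching_mirror p : branching (mirror p) = branching p.
Proof. by case: p => //= a b c; rewrite !internal_mirror; congr (_ <= _)%N; lia. Qed.

Lemma mirror_spine n : mirror (spine n) = spine n.
Proof. by elim: n => //= n ->. Qed.

Lemma mirror_context K :
  context K -> exists2 K', context K' & forall p, mirror (K p) = K' (mirror p).
Proof.
elim=> [|{}K b c _ [K' cK' eK]|{}K a c _ [K' cK' eK]|{}K a b _ [K' cK' eK]].
- by exists id => //; constructor.
- exists (fun p => Node (mirror c) (mirror b) (K' p)); first by constructor.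
  by move=> p /=; rewrite eK.
- exists (fun p => Node (mirror c) (K' p) (mirror a)); first by constructor.
  by move=> p /=; rewrite eK.
- exists (fun p => Node (K' p) (mirror b) (mirror a)); first by constructor.
  by move=> p /=; rewrite eK.
Qed.

(** * Functions on trees that vanish on the ideal *)

Section Annihilators.

Variable F : fieldType.
Hypothesis nz2 : 2%:R != 0 :> F.
Hypothesis nz3 : 3%:R != 0 :> F.

Implicit Types (f : tree -> F) (p u v : tree).

Definition assoc_sum f (a b c d e : tree) : F :=
  f (Node (Node a b c) d e) + f (Node a (Node b c d) e)
  + f (Node a b (Node c d e)).

(** The elements of the ideal are spanned by the sums K[[abc]de] + K[a[bcd]e]
    + K[ab[cde]], so an annihilator is a linear functional on the quotient,
    given by its values on trees.  Quantifying over contexts makes the notion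
    stable under precomposition with a context, which drives the inductions. *)
Definition annihilator f : Prop :=
  forall K, context K -> forall a b c d e,
    assoc_sum (fun p => f (K p)) a b c d e = 0.

Lemma annihilatorE f a b c d e :
  annihilator f -> assoc_sum f a b c d e = 0.
Proof. by move=> annf; apply: (annf id); constructor. Qed.

Lemma annihilator1 f b c :
  annihilator f -> annihilator (fun p => f (Node p b c)).
Proof.
by move=> annf K cK; apply: (annf (fun p => Node (K p) b c)); constructor.
Qed.

Lemma annihilator2 f a c :
  annihilator f -> annihilator (fun p => f (Node a p c)).
Proof.
by move=> annf K cK; apply: (annf (fun p => Node a (K p) c)); constructor.
Qed.

Lemma annihilator3 f a b :
  annihilator f -> annihilator (fun p => f (Node a b p)).
Proof.
by move=> annf K cK; apply: (annf (fun p => Node a b (K p))); constructor.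
Qed.

(** The relation is invariant under left-right reflection, which halves the
    number of identities to be checked. *)
Lemma annihilator_mirror f :
  annihilator f -> annihilator (fun p => f (mirror p)).
Proof.
move=> annf K /mirror_context[K' cK' eK] a b c d e.
rewrite -(annf K' cK' (mirror e) (mirror d) (mirror c) (mirror b) (mirror a)).
by rewrite /assoc_sum !eK /=; ring.
Qed.

(** * Trees with several internal siblings *)

Let double_eq0 (x : F) : x + x = 0 -> x = 0.
Proof.
by move/eqP; rewrite -mulr2n -mulr_natl mulf_eq0 (negPf nz2) => /eqP.
Qed.

Let triple_eq0 (x : F) : x + x + x = 0 -> x = 0.
Proof.
have -> : x + x + x = 3%:R * x by ring.
by move/eqP; rewrite mulf_eq0 (negPf nz3) => /eqP.
Qed.

Definition pair_sum f (a b c d e g h : tree) : F :=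
  f (Node (Node a b c) (Node d e g) h) + f (Node (Node a b c) d (Node e g h))
  + f (Node a (Node b c d) (Node e g h)).

(** Insert a bracket into each of the five arguments of the relation in turn,
    and subtract the relation plugged into each of the three inputs of a vertex.
    All nested trees cancel, and each tree with two sibling brackets is
    left with multiplicity two. *)
Lemma pair_sum_eq0 f a b c d e g h :
  annihilator f -> pair_sum f a b c d e g h = 0.
Proof.
move=> annf; apply: double_eq0.
transitivity (assoc_sum f (Node a b c) d e g h + assoc_sum f a (Node b c d) e g h
  + assoc_sum f a b (Node c d e) g h + assoc_sum f a b c (Node d e g) h
  + assoc_sum f a b c d (Node e g h)
  - (assoc_sum (fun p => f (Node p g h)) a b c d e
     + assoc_sum (fun p => f (Node a p h)) b c d e g
     + assoc_sum (fun p => f (Node a b p)) c d e g h)).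
  by rewrite /assoc_sum /pair_sum; ring.
rewrite !annihilatorE //; first by ring.
- exact: annihilator3.
- exact: annihilator2.
- exact: annihilator1.
Qed.

(** The same counting one weight higher: inserting a bracket into each of the
    seven arguments of [pair_sum] produces the tree with three sibling brackets
    three times, and the remaining trees group into the relation plugged next
    to a bracket. *)
Lemma internal3_eq0 f a b c :
  annihilator f -> internal a -> internal b -> internal c -> f (Node a b c) = 0.
Proof.
move=> annf /internalP[a1 [a2 [a3 ->]]] /internalP[a4 [a5 [a6 ->]]].
move=> /internalP[a7 [a8 [a9 ->]]].
apply: triple_eq0.
transitivity (
  pair_sum f (Node a1 a2 a3) a4 a5 a6 a7 a8 a9
  + pair_sum f a1 (Node a2 a3 a4) a5 a6 a7 a8 a9
  + pair_sum f a1 a2 (Node a3 a4 a5) a6 a7 a8 a9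
  + pair_sum f a1 a2 a3 (Node a4 a5 a6) a7 a8 a9
  + pair_sum f a1 a2 a3 a4 (Node a5 a6 a7) a8 a9
  + pair_sum f a1 a2 a3 a4 a5 (Node a6 a7 a8) a9
  + pair_sum f a1 a2 a3 a4 a5 a6 (Node a7 a8 a9)
  - (assoc_sum (fun p => f (Node p (Node a6 a7 a8) a9)) a1 a2 a3 a4 a5
     + assoc_sum (fun p => f (Node p a6 (Node a7 a8 a9))) a1 a2 a3 a4 a5
     + assoc_sum (fun p => f (Node (Node a1 a2 a3) p a9)) a4 a5 a6 a7 a8
     + assoc_sum (fun p => f (Node a1 p (Node a7 a8 a9))) a2 a3 a4 a5 a6
     + assoc_sum (fun p => f (Node (Node a1 a2 a3) a4 p)) a5 a6 a7 a8 a9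
     + assoc_sum (fun p => f (Node a1 (Node a2 a3 a4) p)) a5 a6 a7 a8 a9)).
  by rewrite /assoc_sum /pair_sum; ring.
rewrite !pair_sum_eq0 // !annihilatorE; first by ring.
all: by [exact: annihilator1 | exact: annihilator2 | exact: annihilator3].
Qed.

(** In the next lemmas the root of the tree has one child whose own j-th and
    k-th subtrees are internal, and [inner]i[_]jk says that the tree vanishes
    when this child is in position i.  The linear combinations come from Gaussian
    elimination among the relations of weight four, in an order in which each
    lemma can use the vanishing given by the previous ones. *)
Lemma inner1_23 f a b c d e :
  annihilator f -> internal b -> internal c ->
  f (Node (Node a b c) d e) = 0.
Proof.
move=> annf /internalP[b1 [b2 [b3 ->]]] /internalP[c1 [c2 [c3 ->]]].
transitivity (pair_sum (fun p => f (Node p d e)) a b1 b2 b3 c1 c2 c3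
  - assoc_sum (fun p => f (Node p d e)) (Node a b1 b2) b3 c1 c2 c3
  + assoc_sum f (Node (Node a b1 b2) b3 c1) c2 c3 d e
  - pair_sum f (Node a b1 b2) b3 c1 c2 c3 d e
  + f (Node (Node a b1 b2) (Node b3 c1 c2) (Node c3 d e))).
  by rewrite /assoc_sum /pair_sum; ring.
have annf1 := annihilator1 d e annf.
by rewrite internal3_eq0 // !pair_sum_eq0 // !annihilatorE // !(subr0, addr0).
Qed.

Lemma inner3_12 f a b c d e :
  annihilator f -> internal c -> internal d ->
  f (Node a b (Node c d e)) = 0.
Proof.
move=> /annihilator_mirror annf ic id.
have := @inner1_23 _ (mirror e) (mirror d) (mirror c) (mirror b) (mirror a) annf.
by rewrite /= !internal_mirror !mirrorK; apply.
Qed.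

Lemma inner2_12 f a b c d e :
  annihilator f -> internal b -> internal c ->
  f (Node a (Node b c d) e) = 0.
Proof.
move=> annf /internalP[b1 [b2 [b3 ->]]] /internalP[c1 [c2 [c3 ->]]].
transitivity (pair_sum (fun p => f (Node a p e)) b1 b2 b3 c1 c2 c3 d
  + pair_sum f a b1 b2 b3 c1 (Node c2 c3 d) e
  + assoc_sum (fun p => f (Node p (Node c2 c3 d) e)) a b1 b2 b3 c1
  - assoc_sum f a (Node b1 b2 b3) c1 (Node c2 c3 d) e
  - assoc_sum f a b1 (Node b2 b3 c1) (Node c2 c3 d) e
  - assoc_sum f (Node a b1 b2) b3 c1 (Node c2 c3 d) e
  + f (Node a b1 (Node (Node b2 b3 c1) (Node c2 c3 d) e))).
  by rewrite /assoc_sum /pair_sum; ring.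
rewrite inner3_12 // !pair_sum_eq0 // ?annihilatorE //; first by ring.
  exact: annihilator1.
exact: annihilator2.
Qed.

Lemma inner2_23 f a b c d e :
  annihilator f -> internal c -> internal d ->
  f (Node a (Node b c d) e) = 0.
Proof.
move=> /annihilator_mirror annf ic id.
have := @inner2_12 _ (mirror e) (mirror d) (mirror c) (mirror b) (mirror a) annf.
by rewrite /= !internal_mirror !mirrorK; apply.
Qed.

Lemma inner1_13 f a b c d e :
  annihilator f -> internal a -> internal c ->
  f (Node (Node a b c) d e) = 0.
Proof.
move=> annf /internalP[a1 [a2 [a3 ->]]] /internalP[c1 [c2 [c3 ->]]].
transitivity (assoc_sum f (Node a1 a2 a3) b (Node c1 c2 c3) d e
  + assoc_sum f a1 (Node a2 a3 b) (Node c1 c2 c3) d e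
  - pair_sum f a1 a2 a3 b (Node c1 c2 c3) d e
  - f (Node (Node a1 (Node a2 a3 b) (Node c1 c2 c3)) d e)
  - f (Node a1 (Node (Node a2 a3 b) (Node c1 c2 c3) d) e)).
  by rewrite /assoc_sum /pair_sum; ring.
rewrite inner1_23 // inner2_12 // pair_sum_eq0 // !annihilatorE //; ring.
Qed.

Lemma inner1_12 f a b c d e :
  annihilator f -> internal a -> internal b ->
  f (Node (Node a b c) d e) = 0.
Proof.
move=> annf /internalP[a1 [a2 [a3 ->]]] /internalP[b1 [b2 [b3 ->]]].
have := pair_sum_eq0 a1 a2 a3 b1 b2 b3 c (annihilator1 d e annf).
by rewrite /pair_sum [X in _ + X + _]inner1_13 // [X in _ + X]inner1_23 // !addr0.
Qed.

Lemma inner2_13 f a b c d e :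
  annihilator f -> internal b -> internal d ->
  f (Node a (Node b c d) e) = 0.
Proof.
move=> annf /internalP[b1 [b2 [b3 ->]]] /internalP[d1 [d2 [d3 ->]]].
have := pair_sum_eq0 b1 b2 b3 c d1 d2 d3 (annihilator2 a e annf).
by rewrite /pair_sum [X in X + _ + _]inner2_12 // [X in _ + X]inner2_23 // addr0 add0r.
Qed.

Lemma branching1_eq0 f p b c : annihilator f -> branching p -> f (Node p b c) = 0.
Proof.
case: p => // p q r annf /=.
case ip: (internal p); case iq: (internal q); case ir: (internal r) => // _.
- by rewrite inner1_12.
- by rewrite inner1_12.
- by rewrite inner1_13.
- by rewrite inner1_23.
Qed.

Lemma branching2_eq0 f p a c : annihilator f -> branching p -> f (Node a p c) = 0.
Proof.
case: p => // p q r annf /=.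
case ip: (internal p); case iq: (internal q); case ir: (internal r) => // _.
- by rewrite inner2_12.
- by rewrite inner2_12.
- by rewrite inner2_13.
- by rewrite inner2_23.
Qed.

Lemma branching3_eq0 f p a b : annihilator f -> branching p -> f (Node a b p) = 0.
Proof.
move=> /annihilator_mirror annf bp.
have := @branching1_eq0 _ (mirror p) (mirror b) (mirror a) annf.
by rewrite /= branching_mirror !mirrorK; apply.
Qed.

(** * Reduction to the normal forms *)

(** When the trees with two internal siblings can be dropped, the relation
    becomes a set of commutation rules for the operators L_i that attach a
    caterpillar as the i-th child of a root with two leaves.  Any word in the
    L_i is rewritten into the two words L_2^n and L_3 L_2^(n-1) applied to a leaf.
    The induction is on f, replaced by its composites with L_2, L_3 and L_1 in
    this order: each case uses the vanishing obtained in the previous ones.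
    Inside a context the hypothesis on branching trees is automatic. *)
Lemma caterpillar_eq0 n f :
  annihilator f -> (forall p, weight p = n.+1 -> branching p -> f p = 0) ->
  f (spine n.+1) = 0 -> f (Node Leaf Leaf (spine n)) = 0 ->
  forall p, weight p = n.+1 -> f p = 0.
Proof.
elim: n f => [|n IHn] f annf brf fspine fright.
  case=> //= a b c [/eqP]; rewrite !addn_eq0 -andbA.
  by case/and3P=> /eqP/weight0-> /eqP/weight0-> /eqP/weight0->.
have ann1 := annihilator1 Leaf Leaf annf.
have ann2 := annihilator2 Leaf Leaf annf.
have ann3 := annihilator3 Leaf Leaf annf.
have f2 p : weight p = n.+1 -> f (Node Leaf p Leaf) = 0.
  apply: (IHn _ ann2) => {p} [p _ bp||]; [exact: branching2_eq0 | by [] |].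
  (* L_2 L_3 = - L_3 L_2 *)
  case: n {IHn} brf fspine fright => [//|n] brf fspine fright.
  have := annihilatorE Leaf Leaf Leaf (spine n.+1) Leaf annf.
  rewrite /assoc_sum fright addr0 brf //= ?weight_spine ?addn0 //.
  by rewrite add0r.
have f3 p : weight p = n.+1 -> f (Node Leaf Leaf p) = 0.
  apply: (IHn _ ann3) => {p} [p _ bp||]; [exact: branching3_eq0 | by [] |].
  (* L_3 L_3 = 0 *)
  case: n {IHn} brf fspine fright f2 => [//|n] brf fspine fright f2.
  have := annihilatorE Leaf Leaf Leaf Leaf (spine n.+1) annf.
  rewrite /assoc_sum [X in X + _ + _]brf //= ?weight_spine ?addn0 //.
  by rewrite [X in _ + X + _]brf //= ?weight_spine ?addn0 // !add0r.
have f1 p : weight p = n.+1 -> f (Node p Leaf Leaf) = 0.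
  apply: (IHn _ ann1) => {p} [p _ bp||]; first exact: branching1_eq0.
    (* L_1 L_2 = - L_2 L_1, corrected by L_3 when the spine is a leaf *)
    have := annihilatorE Leaf (spine n) Leaf Leaf Leaf annf.
    rewrite /assoc_sum f2 /= ?weight_spine ?addn0 // addr0.
    case: n {IHn} brf fspine fright f2 f3 => [|n] brf fspine fright f2 f3.
      by rewrite /= f3 // addr0.
    by rewrite [X in _ + X]brf ?addr0 //= ?weight_spine; lia.
  (* L_1 L_3 + L_3 L_1 = - L_2^2 *)
  have := annihilatorE Leaf Leaf (spine n) Leaf Leaf annf.
  by rewrite /assoc_sum f2 ?f3 /= ?weight_spine ?addn0 ?addr0.
case=> // a b c wp.
case bp: (branching (Node a b c)); first exact: brf.
move: bp wp => /=; case: a => [|a1 a2 a3]; case: b => [|b1 b2 b3];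
  case: c => [|c1 c2 c3] //= _ [wp].
- by apply: f3; rewrite -wp.
- by apply: f2; rewrite -wp addn0.
- by apply: f1; rewrite -wp !addn0.
Qed.

Lemma caterpillar_eq0_mirror n f :
  annihilator f -> (forall p, weight p = n.+1 -> branching p -> f p = 0) ->
  f (spine n.+1) = 0 -> f (Node (spine n) Leaf Leaf) = 0 ->
  forall p, weight p = n.+1 -> f p = 0.
Proof.
move=> annf brf f0 f1 p wp; rewrite -[p]mirrorK.
apply: (caterpillar_eq0 (n := n) (annihilator_mirror annf)).
- by move=> q wq bq; rewrite brf ?weight_mirror ?branching_mirror.
- by rewrite mirror_spine.
- by rewrite /= mirror_spine.
- by rewrite weight_mirror.
Qed.

(** In [fork]jk the root subtrees j and k are internal and the other one is a
    leaf.  Placing two internal trees among the five arguments of the relation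
    and dropping the trees known to vanish gives the following rules. *)
Lemma fork23_right f u v : annihilator f -> internal u -> internal v ->
  f (Node Leaf (Node Leaf Leaf u) v) = 0.
Proof.
move=> annf iu iv; have := annihilatorE Leaf Leaf Leaf u v annf.
rewrite /assoc_sum [X in X + _ + _]internal3_eq0 // [X in _ + X]branching3_eq0 //=.
  by rewrite addr0 add0r.
by rewrite iu iv.
Qed.

Lemma fork23_left f u v : annihilator f -> internal u -> internal v ->
  f (Node Leaf u (Node v Leaf Leaf)) = 0.
Proof.
move=> annf iu iv; have := annihilatorE Leaf u v Leaf Leaf annf.
rewrite /assoc_sum [X in X + _ + _]branching1_eq0 //= ?iu ?iv //.
by rewrite [X in _ + X + _]branching2_eq0 //= ?iu ?iv // !add0r.
Qed.

Lemma fork12_right f u v : annihilator f -> internal u -> internal v ->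
  f (Node (Node Leaf Leaf u) v Leaf) = 0.
Proof.
move=> annf iu iv; have := annihilatorE Leaf Leaf u v Leaf annf.
rewrite /assoc_sum [X in _ + X + _]branching2_eq0 //= ?iu ?iv //.
by rewrite [X in _ + X]branching3_eq0 //= ?iu ?iv // !addr0.
Qed.

Lemma fork12_left f u v : annihilator f -> internal u -> internal v ->
  f (Node u (Node v Leaf Leaf) Leaf) = 0.
Proof.
move=> annf iu iv; have := annihilatorE u v Leaf Leaf Leaf annf.
rewrite /assoc_sum [X in X + _ + _]branching1_eq0 //= ?iu ?iv //.
by rewrite [X in _ + X]internal3_eq0 //= add0r addr0.
Qed.

Lemma fork12_mid f u v : annihilator f -> internal u -> internal v ->
  f (Node (Node Leaf u Leaf) v Leaf) = - f (Node Leaf u (Node Leaf v Leaf)).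
Proof.
move=> annf iu iv; have := annihilatorE Leaf u Leaf v Leaf annf.
rewrite /assoc_sum [X in _ + X + _]branching2_eq0 //= ?iu ?iv // addr0.
by move/eqP; rewrite addr_eq0 => /eqP.
Qed.

(** The functions f below vanish on the normal forms of weight n + 3. *)
Section Forks.

Variables (f : tree -> F) (n : nat).
Hypothesis annf : annihilator f.
Hypothesis f_spines : forall i, (i < n.+3)%N ->
  f (Node Leaf (spine i) (spine (n.+2 - i))) = 0.
Hypothesis f_extra : f (Node (spine 1) (spine n.+1) Leaf) = 0.

(** The right subtree reduces to s_j and L_1 s_(j-1), the latter being killed by
    [fork23_left]; the middle one reduces to s_i and L_3 s_(i-1), the latter
    being killed by [fork23_right].  This leaves a normal form. *)
Lemma fork23_eq0 u v : internal u -> internal v ->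
  (weight u + weight v)%N = n.+2 -> f (Node Leaf u v) = 0.
Proof.
rewrite !internalE; case wu: (weight u) => [|i] //; case wv: (weight v) => [|j] // _ _ ij.
have br23 p q : branching q -> f (Node Leaf p q) = 0.
  exact: branching3_eq0.
have fv q : weight q = j.+1 -> f (Node Leaf (spine i.+1) q) = 0.
  apply: (caterpillar_eq0_mirror (annihilator3 Leaf (spine i.+1) annf)) => {q} [q _||].
  - exact: br23.
  - by have := f_spines (i := i.+1); rewrite (_ : n.+2 - i.+1 = j.+1)%N; [apply; lia | lia].
  - case: j wv ij => [|j] wv ij; last by apply: fork23_left.
    by have := f_spines (i := i.+1); rewrite (_ : n.+2 - i.+1 = 1)%N; [apply; lia | lia].
apply: (caterpillar_eq0 (annihilator2 Leaf v annf)) wu => [q _ bq||].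
- exact: branching2_eq0.
- exact: fv.
- case: i fv {ij} => [|i] fv; first exact: (fv _ wv).
  by apply: fork23_right; rewrite // internalE wv.
Qed.

(** The left subtree reduces to s_i and L_3 s_(i-1).  If i > 1, then
    [fork12_mid] turns the tree on s_i into a [fork23] tree and [fork12_right]
    kills the other one.  If i = 1, then reducing the right subtree to s_j and
    L_1 s_(j-1), the latter killed by [fork12_left], leaves the extra normal
    form. *)
Lemma fork12_eq0 u v : internal u -> internal v ->
  (weight u + weight v)%N = n.+2 -> f (Node u v Leaf) = 0.
Proof.
rewrite !internalE; case wu: (weight u) => [|i] //; case wv: (weight v) => [|j] // _ _ ij.
have iv : internal v by rewrite internalE wv.
have fm q : weight q = n.+1 -> f (Node (spine 1) q Leaf) = 0.
  apply: (caterpillar_eq0_mirror (annihilator2 (spine 1) Leaf annf)) => {q} [q _ bq||].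
  - exact: branching2_eq0.
  - exact: f_extra.
  - by case: n f_extra => // m _; apply: fork12_left.
apply: (caterpillar_eq0 (annihilator1 v Leaf annf)) wu => [q _ bq||].
- exact: branching1_eq0.
- case: i ij => [|i] ij; first by apply: fm; lia.
  rewrite [LHS]fork12_mid // fork23_eq0 ?oppr0 //= ?weight_spine ?wv; lia.
- case: i ij => [|i] ij; first by apply: fm; lia.
  exact: fork12_right.
Qed.

(** The relation [pair_sum] with a leaf between the two brackets expresses a
    [fork13] tree by two trees that either have three internal root subtrees or
    are of type [fork12] or [fork23]. *)
Lemma fork13_eq0 u v : internal u -> internal v ->
  (weight u + weight v)%N = n.+2 -> f (Node u Leaf v) = 0.
Proof.
move=> /internalP[a [b [c ->]]] /internalP[d [e [g ->]]] wuv.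
have := pair_sum_eq0 a b c Leaf d e g annf; rewrite /pair_sum.
have -> : f (Node (Node a b c) (Node Leaf d e) g) = 0.
  case ig: (internal g); first exact: internal3_eq0.
  case: g ig wuv => // _ wuv.
  by apply: fork12_eq0 => //; rewrite -wuv /=; lia.
have -> : f (Node a (Node b c Leaf) (Node d e g)) = 0.
  case ia: (internal a); first exact: internal3_eq0.
  case: a ia wuv => // _ wuv.
  by apply: fork23_eq0 => //; rewrite -wuv /=; lia.
by rewrite add0r addr0.
Qed.

Lemma eq0_of_normal_forms p : weight p = n.+3 -> f p = 0.
Proof.
apply: (caterpillar_eq0 annf) => {p} [[] // a b c [wp] /=||].
- case: a wp => [|a1 a2 a3] wp; case: b wp => [|b1 b2 b3] wp;
    case: c wp => [|c1 c2 c3] wp //= _; last exact: internal3_eq0.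
  + exact: fork23_eq0.
  + by apply: fork13_eq0; rewrite //= -wp /= addn0.
  + by apply: fork12_eq0; rewrite //= -wp /= addn0.
- by have := f_spines (i := n.+2); rewrite subnn; apply.
- by have := f_spines (i := 0); rewrite subn0; apply.
Qed.

End Forks.
End Annihilators.

(** * The normal forms span the quotient *)

Section IdealRelations.

Variable F : fieldType.

(** A total version of the basis vectors, zero on trees of the wrong arity,
    which avoids casts between arities. *)
Definition tree_vec n (p : tree) : LT F n := [ffun q : ttree n => (ttval q == p)%:R].

Lemma tree_vecE n (p : ttree n) : tree_vec n p = LTbasis F p.
Proof. by apply/ffunP=> q; rewrite !ffunE val_eqE. Qed.

Lemma tree_vec0 n p : arity p != n -> tree_vec n p = 0.
Proof.
move=> np; apply/ffunP=> q; rewrite !ffunE; case: eqP => // eqp.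
by rewrite -eqp arity_ttree eqxx in np.
Qed.

Lemma LTcomp_tree_vec m n p (i : 'I_m) q : arity p = m -> arity q = n ->
  LTcomp (tree_vec m p) i (tree_vec n q) = tree_vec (m + n).-1 (graft p i q).
Proof.
move=> /eqP ap /eqP aq.
by rewrite (tree_vecE (TTree ap)) (tree_vecE (TTree aq)) LTcomp_basis -tree_vecE.
Qed.

Lemma LTcompDl m n (f1 f2 : LT F m) (i : 'I_m) (g : LT F n) :
  LTcomp (f1 + f2) i g = LTcomp f1 i g + LTcomp f2 i g.
Proof.
rewrite /LTcomp -big_split; apply: eq_bigr => p _ /=.
by rewrite -big_split; apply: eq_bigr => q _ /=; rewrite ffunE mulrDl scalerDl.
Qed.

Lemma LTcompDr m n (f : LT F m) (i : 'I_m) (g1 g2 : LT F n) :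
  LTcomp f i (g1 + g2) = LTcomp f i g1 + LTcomp f i g2.
Proof.
rewrite /LTcomp -big_split; apply: eq_bigr => p _ /=.
by rewrite -big_split; apply: eq_bigr => q _ /=; rewrite ffunE mulrDr scalerDl.
Qed.

(** The arity is quantified so that it follows the grafting operations without
    casts. *)
Definition sum_in_ideal (p1 p2 p3 : tree) : Prop :=
  exists n, [/\ arity p1 = n, arity p2 = n, arity p3 = n &
    tree_vec n p1 + tree_vec n p2 + tree_vec n p3 \in ideal_gen (alpha F) n].

Lemma sum_in_ideal_graftl p1 p2 p3 i q : sum_in_ideal p1 p2 p3 -> (i < arity p1)%N ->
  sum_in_ideal (graft p1 i q) (graft p2 i q) (graft p3 i q).
Proof.
case=> n [a1 a2 a3 I123]; rewrite a1 => lti; exists (n + arity q).-1.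
rewrite !arity_graft ?a1 ?a2 ?a3 //; split=> //.
have [+ _] := ideal_gen_ideal (tree_vec (arity q) q) I123.
by move/(_ (Ordinal lti)); rewrite !LTcompDl !LTcomp_tree_vec.
Qed.

Lemma sum_in_ideal_graftr p1 p2 p3 i q : sum_in_ideal p1 p2 p3 -> (i < arity q)%N ->
  sum_in_ideal (graft q i p1) (graft q i p2) (graft q i p3).
Proof.
case=> n [a1 a2 a3 I123] lti; exists (arity q + n).-1.
rewrite !arity_graft // a1 a2 a3; split=> //.
have [_ +] := ideal_gen_ideal (tree_vec (arity q) q) I123.
by move/(_ (Ordinal lti)); rewrite !LTcompDr !LTcomp_tree_vec.
Qed.

(** Grafting at the rightmost leaf first keeps the positions of the other
    leaves unchanged. *)
Lemma sum_in_ideal_assoc a b c d e : sum_in_ideal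
  (Node (Node a b c) d e) (Node a (Node b c d) e) (Node a b (Node c d e)).
Proof.
pose Y := Node Leaf Leaf Leaf.
have : sum_in_ideal (Node Y Leaf Leaf) (Node Leaf Y Leaf) (Node Leaf Leaf Y).
  exists 5; split=> //; have := mem_ideal_gen (alpha F).
  by rewrite {1}alphaE -!tree_vecE.
move=> /(sum_in_ideal_graftl (i := 4) e)/(_ isT).
move=> /(sum_in_ideal_graftl (i := 3) d)/(_ isT).
move=> /(sum_in_ideal_graftl (i := 2) c)/(_ isT).
move=> /(sum_in_ideal_graftl (i := 1) b)/(_ isT).
by move=> /(sum_in_ideal_graftl (i := 0) a)/(_ isT).
Qed.

Lemma sum_in_ideal_context K p1 p2 p3 : context K ->
  sum_in_ideal p1 p2 p3 -> sum_in_ideal (K p1) (K p2) (K p3).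
Proof.
move=> cK I123; elim: cK => // {}K a b _.
- by move/(sum_in_ideal_graftr (q := Node Leaf a b) (i := 0))/(_ isT).
- move/(sum_in_ideal_graftr (q := Node a Leaf b) (i := arity a)) => /=.
  by rewrite ltnn addn1 ltnSn; apply; lia.
- move/(sum_in_ideal_graftr (q := Node a b Leaf) (i := arity a + arity b)) => /=.
  have -> : (arity a + arity b < arity a)%N = false by lia.
  by rewrite ltnn; apply; lia.
Qed.

Lemma annihilator_ideal n (L : {linear LT F n -> F^o}) :
  (forall x, x \in ideal_gen (alpha F) n -> L x = 0) ->
  annihilator (fun p => L (tree_vec n p)).
Proof.
move=> L0 K cK a b c d e.
have [m [a1 a2 a3 I123]] := sum_in_ideal_context cK (sum_in_ideal_assoc a b c d e).
rewrite /assoc_sum -!linearD; have [mn|nm] := eqVneq m n.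
  by move: I123; rewrite mn => /L0.
by rewrite !tree_vec0 ?a1 ?a2 ?a3 // !addr0 linear0.
Qed.

(** The last index, i = k, is that of the only normal form which is not of the
    shape [x s_i s_j]; i = k - 1 gives s_k and i = 0 gives L_3 s_(k-1). *)
Definition normal_form (k i : nat) : tree :=
  if (i < k)%N then Node Leaf (spine i) (spine (k.-1 - i))
  else Node (spine 1) (spine (k - 2)) Leaf.

Hypothesis charF0 : [pchar F] =i pred0.

Definition normal_vecs k : k.+1.-tuple (LT F (2 * k + 1)) :=
  [tuple tree_vec (2 * k + 1) (normal_form k i) | i < k.+1].

Lemma ideal_normal_full k : (3 <= k)%N ->
  (ideal_gen (alpha F) (2 * k + 1) + <<normal_vecs k>>)%VS = fullv.
Proof.
case: k => [|[|[|n]]] // _; set k := n.+3; set N := (2 * k + 1)%N.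
set W := (_ + _)%VS; apply/eqP; rewrite eqEsubv subvf /=; apply/subvP=> x _.
suff x0 : piv W x = 0.
  by have := piv_eq W x 0; rewrite subr0 /piv raddf0 -/(piv W x) x0 eqxx => <-.
have nzn m : m.+1%:R != 0 :> F by rewrite ((pcharf0P F).1 charF0).
rewrite (LTbasisE x) [LHS]linear_sum big1 // => p _; rewrite linearZ /=.
suff -> : piv W (LTbasis F p) = 0 by rewrite scaler0.
rewrite (coord_vbasis (memvf (piv W (LTbasis F p)))) big1 // => i _.
(* each coordinate of the quotient by W is a functional that vanishes on W *)
set L : {linear LT F N -> F^o} := (coord (vbasis fullv) i \o piv W : _ -> F^o).
have LW y : y \in W -> L y = 0.
  move=> Wy; have /eqP piy : piv W y == piv W 0 by rewrite piv_eq subr0.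
  by rewrite (_ : L y = coord (vbasis fullv) i (piv W y)) // piy !linear0.
have Lnf j : (j < k.+1)%N -> L (tree_vec N (normal_form k j)) = 0.
  move=> ltj; apply/LW/(subvP (addvSr _ _))/memv_span.
  by apply/mapP; exists (Ordinal ltj); rewrite // mem_enum.
suff Lp : L (LTbasis F p) = 0 by rewrite [X in X *: _]Lp scale0r.
rewrite -tree_vecE.
apply: (eq0_of_normal_forms (n := n) (nzn 1%N) (nzn 2%N) (f := fun p => L (tree_vec N p))).
- by apply: annihilator_ideal => y yI; apply: LW; apply: (subvP (addvSl _ _)).
- move=> j ltj; have := Lnf j (ltnW ltj).
  by rewrite /normal_form ltj.
- by have := Lnf k (ltnSn k); rewrite /normal_form ltnn.
- by have := arity_ttree p; rewrite arity_weight /N; lia.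
Qed.

End IdealRelations.

(** * A partially associative algebra *)

Lemma linear_fun_sum (R : pzRingType) (U V : lmodType R) (h : U -> V) (I : Type)
    (r : seq I) (c : I -> R) (u : I -> U) :
  linear h -> h (\sum_(k <- r) c k *: u k) = \sum_(k <- r) c k *: h (u k).
Proof.
move=> hlin; pose L : {linear U -> V} := HB.pack h (GRing.isLinear.Build R U V _ h hlin).
rewrite [LHS](linear_sum L); apply: eq_bigr => k _; exact: (linearZ_LR L).
Qed.

Lemma linear_fun0 (R : pzRingType) (U V : lmodType R) (h : U -> V) :
  linear h -> h 0 = 0.
Proof.
by move=> hlin; have := linear_fun_sum (Nil unit) (fun=> 0) (fun=> 0) hlin; rewrite !big_nil.
Qed.

(** An element u of the algebra consists of a scalar u_0, two power series
    phi_u and psi_u in one variable, and a power series chi_u in two variables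
    s and t; the index set enumerates the coefficients. *)
Inductive model_index := One | Phi of nat | Psi of nat | Chi of nat & nat.

Section Model.

Variable F : fieldType.

Definition model := model_index -> F^o.

Implicit Types (u v w : model) (env : nat -> model).

(** The series E(u, v) = u_0 psi_v + v_0 phi_u + u_0 v_0, through which all
    products are expressed. *)
Definition cross u v (l : nat) : F :=
  u One * v (Psi l) + v One * u (Phi l) + (l == 0%N)%:R * (u One * v One).

(** The product [uvw] has scalar part 0, and
      phi = X u_0 E(v, w),
      psi = - X w_0 E(u, v),
      chi = s E(u, v)(s) phi_w(t) + t psi_u(s) E(v, w)(t).
    On the subalgebra generated by the element with scalar part 1 and no other
    part, these are the structure constants of the quotient in a basis adapted
    to the normal forms: phi and psi record the two caterpillars of each weight,
    and chi the trees with two internal root subtrees. *)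
Definition model_mul u v w : model := fun k =>
  match k with
  | One => 0
  | Phi l => if l is l'.+1 then u One * cross v w l' else 0
  | Psi l => if l is l'.+1 then - (w One * cross u v l') else 0
  | Chi i j => (if i is i'.+1 then cross u v i' * w (Phi j) else 0)
             + (if j is j'.+1 then u (Psi i) * cross v w j' else 0)
  end.

(** The key point is E([uvw], z) = X u_0 z_0 E(v, w) = - E(u, [vwz]), since
    products have no scalar part; with it the phi, psi and chi parts of the
    three terms cancel in pairs. *)
Lemma model_mul_assoc a b c d e :
  model_mul (model_mul a b c) d e + model_mul a (model_mul b c d) e
  + model_mul a b (model_mul c d e) = 0.
Proof.
apply/funext=> k; rewrite [RHS](_ : _ = 0 :> F) // !fctE.
case: k => [|[|[|l]]|[|[|l]]|[|[|i]] [|[|j]]] /=; rewrite ?/cross /=; ring.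
Qed.

Lemma model_mul_linear1 v w x a b :
  model_mul (x *: a + b) v w = x *: model_mul a v w + model_mul b v w.
Proof.
apply/funext=> k; rewrite !fctE.
by case: k => [|[|l]|[|l]|[|i] [|j]]; rewrite /= ?/cross ?fctE /GRing.scale /=; ring.
Qed.

Lemma model_mul_linear2 u w x a b :
  model_mul u (x *: a + b) w = x *: model_mul u a w + model_mul u b w.
Proof.
apply/funext=> k; rewrite !fctE.
by case: k => [|[|l]|[|l]|[|i] [|j]]; rewrite /= ?/cross ?fctE /GRing.scale /=; ring.
Qed.

Lemma model_mul_linear3 u v x a b :
  model_mul u v (x *: a + b) = x *: model_mul u v a + model_mul u v b.
Proof.
apply/funext=> k; rewrite !fctE.
by case: k => [|[|l]|[|l]|[|i] [|j]]; rewrite /= ?/cross ?fctE /GRing.scale /=; ring.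
Qed.

(** The l-th leaf, counted from 0, takes the value [env l]. *)
Fixpoint eval (p : tree) env : model :=
  if p is Node a b c then
    model_mul (eval a env) (eval b (fun l => env (arity a + l)%N))
              (eval c (fun l => env (arity a + arity b + l)%N))
  else env 0%N.

Definition update env i u : nat -> model := fun l => if l == i then u else env l.

Lemma eval_ext p env env' :
  (forall l, (l < arity p)%N -> env l = env' l) -> eval p env = eval p env'.
Proof.
elim: p env env' => [|a IHa b IHb c IHc] env env' eqe /=; first exact: eqe.
by congr model_mul; [apply: IHa|apply: IHb|apply: IHc] => l ltl; apply: eqe => /=; lia.
Qed.

(** The environment left after the [m] consecutive leaves starting at [i] have
    been merged into a single one. *)
Definition contract env i m : nat -> model :=
  fun l => if (l < i)%N then env l else env (l + m).-1.

Lemma eval_graft p i q env : (i < arity p)%N ->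
  eval (graft p i q) env
  = eval p (update (contract env i (arity q)) i (eval q (fun l => env (i + l)%N))).
Proof.
have q0 := arity_gt0 q.
elim: p i env => [|a IHa b IHb c IHc] i env /= lti.
  by move: lti; rewrite ltnS leqn0 /update => /eqP->; apply: eval_ext => l _; rewrite add0n.
case: ltnP => [ltia|leai] /=.
  rewrite IHa // !arity_graft //; congr model_mul; apply: eval_ext => l ltl.
  - rewrite /update /contract; case: eqP => [|_]; first lia.
    by case: ltnP => [|_]; first lia; congr (env _); lia.
  - rewrite /update /contract; case: eqP => [|_]; first lia.
    by case: ltnP => [|_]; first lia; congr (env _); lia.
case: ltnP => [ltib|leib] /=.
  rewrite IHb; last lia.
  rewrite !arity_graft; last lia.
  congr model_mul; apply: eval_ext => l ltl.
  - rewrite /update /contract; case: eqP => [|_]; first lia.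
    by case: ltnP => [//|]; lia.
  - rewrite /update /contract.
    have -> : (l == i - arity a)%N = (arity a + l == i)%N by lia.
    have -> : (l < i - arity a)%N = (arity a + l < i)%N by lia.
    case: eqP => [li|nli].
      by apply: eval_ext => m _; congr (env _); lia.
    by case: ltnP => // ?; congr (env _); lia.
  - rewrite /update /contract; case: eqP => [|_]; first lia.
    by case: ltnP => [|_]; first lia; congr (env _); lia.
rewrite IHc; last lia.
congr model_mul; apply: eval_ext => l ltl.
- rewrite /update /contract; case: eqP => [|_]; first lia.
  by case: ltnP => [//|]; lia.
- rewrite /update /contract; case: eqP => [|_]; first lia.
  by case: ltnP => [//|]; lia.
- rewrite /update /contract.
  set s := (arity a + arity b)%N in leib *.
  have -> : (l == i - s)%N = (s + l == i)%N by lia.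
  have -> : (l < i - s)%N = (s + l < i)%N by lia.
  case: eqP => [li|nli].
    by apply: eval_ext => m _; congr (env _); lia.
  by case: ltnP => // ?; congr (env _); lia.
Qed.

Lemma eval_linear p env i x u v : (i < arity p)%N ->
  eval p (update env i (x *: u + v))
  = x *: eval p (update env i u) + eval p (update env i v).
Proof.
elim: p env i => [|a IHa b IHb c IHc] env i /= lti.
  by move: lti; rewrite ltnS leqn0 /update eq_sym => ->.
have updl n m w : (i < n)%N \/ (n + m <= i)%N -> forall q, arity q = m ->
    eval q (fun l => update env i w (n + l)%N) = eval q (fun l => env (n + l)%N).
  move=> nm q aq; apply: eval_ext => l ltl; rewrite /update.
  by case: eqP => // ?; lia.
have updn n w : (n <= i)%N ->
    (fun l => update env i w (n + l)%N) = update (fun l => env (n + l)%N) (i - n)%N w.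
  move=> ni; apply/funext=> l; rewrite /update.
  by have -> : (l == i - n)%N = (n + l == i)%N by lia.
have upd0 w : (arity a <= i)%N -> eval a (update env i w) = eval a env.
  move=> ai; apply: eval_ext => l ltl; rewrite /update.
  by case: eqP => // ?; lia.
have [ltia|leai] := ltnP i (arity a).
  rewrite IHa // model_mul_linear1.
  by rewrite !(@updl (arity a) (arity b)) ?(@updl (arity a + arity b)%N (arity c)) //; left; lia.
rewrite !upd0 //; have [ltib|leib] := ltnP i (arity a + arity b).
  rewrite !(@updl (arity a + arity b)%N (arity c)) //; [|by left..].
  rewrite !(updn (arity a)) // IHb; last lia.
  by rewrite model_mul_linear2.
rewrite !(@updl (arity a) (arity b)) //; [|by right..].
rewrite !(updn (arity a + arity b)%N) // IHc; last lia.
by rewrite model_mul_linear3.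
Qed.

Definition eval_vec n (f : LT F n) env : model :=
  \sum_(p : ttree n) f p *: eval p env.

Lemma eval_vec_linear n env x (f g : LT F n) :
  eval_vec (x *: f + g) env = x *: eval_vec f env + eval_vec g env.
Proof.
rewrite /eval_vec scaler_sumr -big_split; apply: eq_bigr => p _ /=.
by rewrite !ffunE scalerDl scalerA.
Qed.

Lemma eval_tree_vec n p env : arity p = n -> eval_vec (tree_vec F n p) env = eval p env.
Proof.
move=> /eqP ap; rewrite /eval_vec (bigD1 (TTree ap)) //= big1 => [|q nq].
  by rewrite ffunE eqxx scale1r addr0.
by rewrite ffunE -[p]/(ttval (TTree ap)) val_eqE (negPf nq) scale0r.
Qed.

Lemma eval_vec_LTcomp m n (f : LT F m) (i : 'I_m) (g : LT F n) env :
  eval_vec (LTcomp f i g) env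
  = \sum_(p : ttree m) \sum_(q : ttree n) (f p * g q) *: eval (graft p i q) env.
Proof.
have vlin : linear (@eval_vec (m + n).-1 ^~ env) by move=> *; apply: eval_vec_linear.
rewrite pair_big /LTcomp pair_big /= (linear_fun_sum _ _ _ vlin).
by apply: eq_bigr => -[p q] _; rewrite -tree_vecE eval_tree_vec // arity_ttree.
Qed.

(** The multilinear operations that vanish identically on the algebra.  The
    algebra is infinite dimensional, hence the intersection of kernels of
    scalar functionals. *)
Definition identities n : {vspace LT F n} :=
  bigcapv (fun U => exists env k,
    U = lker (linfun (fun f : LT F n => \sum_p f p * eval p env k : F^o))).

Lemma identitiesP n (f : LT F n) :
  f \in identities n <-> (forall env, eval_vec f env = 0).
Proof.
have lE env k : linear (fun f : LT F n => \sum_p f p * eval p env k : F^o).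
  move=> x g h; rewrite scaler_sumr -big_split; apply: eq_bigr => p _ /=.
  by rewrite !ffunE mulrDl scalerAl.
have fE env k : eval_vec f env k = \sum_p f p * eval p env k.
  by rewrite /eval_vec fct_sumE.
pose L env k := GRing.isLinear.Build F (LT F n) F^o _ _ (lE env k).
have memE env k : (f \in lker (linfun (fun f : LT F n => \sum_p f p * eval p env k : F^o)))
    = (eval_vec f env k == 0).
  pose LL : {linear LT F n -> F^o} := HB.pack (fun f : LT F n => \sum_p f p * eval p env k : F^o) (L env k).
  by rewrite memv_ker (lfunE LL) /= fE.
rewrite bigcapvP; split=> [fU env|f0 U [env [k ->]]].
  apply/funext=> k; apply/eqP; rewrite -[X in _ == X]/(0 : F) -memE.
  by apply: fU; exists env, k.
by rewrite memE f0.
Qed.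

(** A composite with an identity in the outer position is evaluated as that
    identity in another environment; with an identity in the inner position, it
    is evaluated at 0 in one variable, by linearity. *)
Lemma identities_ideal : operad_ideal identities.
Proof.
move=> m n f g /identitiesP f0; split=> i; apply/identitiesP=> env; rewrite eval_vec_LTcomp.
  rewrite exchange_big big1 // => q _ /=.
  transitivity (g q *: eval_vec f (update (contract env i (arity q)) i (eval q (fun l => env (i + l)%N)))).
    rewrite /eval_vec scaler_sumr; apply: eq_bigr => p _.
    by rewrite eval_graft ?arity_ttree // scalerA mulrC.
  by rewrite f0 scaler0.
rewrite big1 // => q _ /=.
have lti : (i < arity q)%N by rewrite arity_ttree.
have hlin : linear (fun u => eval q (update (contract env i m) i u)).
  by move=> x u v; exact: eval_linear.
transitivity (g q *: eval q (update (contract env i m) i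
    (eval_vec f (fun l => env (i + l)%N)))); last first.
  by rewrite f0 (linear_fun0 hlin) scaler0.
rewrite (linear_fun_sum _ _ _ hlin) scaler_sumr; apply: eq_bigr => p _.
by rewrite eval_graft // arity_ttree scalerA.
Qed.

Lemma alpha_identity : alpha F \in identities 5.
Proof.
apply/identitiesP=> env; rewrite alphaE -!tree_vecE.
set v1 := tree_vec _ _ _; set v2 := tree_vec _ _ _; set v3 := tree_vec _ _ _.
have := eval_vec_linear env 1 (v1 + v2) v3; rewrite !scale1r => ->.
have := eval_vec_linear env 1 v1 v2; rewrite !scale1r => ->.
by rewrite !eval_tree_vec //= model_mul_assoc.
Qed.

Lemma ideal_gen_eval n (f : LT F n) env :
  f \in ideal_gen (alpha F) n -> eval_vec f env = 0.
Proof.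
move=> If; move: env; apply/identitiesP.
exact: (subvP (ideal_gen_min identities_ideal alpha_identity n)).
Qed.

End Model.

(** * The normal forms are independent *)

Section Independence.

Variable F : fieldType.

Definition generator : model F := fun k => if k is One then 1 else 0.

Definition value (p : tree) : model F := eval p (fun=> generator).

Lemma value_Node a b c : value (Node a b c) = model_mul (value a) (value b) (value c).
Proof. by []. Qed.

(** The spine s_n corresponds to the pair (X^n, (-X)^n), with chi = 0. *)
Lemma value_spine n : value (spine n) = fun k =>
  match k with
  | One => (n == 0%N)%:R
  | Phi l => ((0 < n)%N && (l == n))%:R
  | Psi l => (-1) ^+ n * ((0 < n)%N && (l == n))%:R
  | Chi _ _ => 0
  end.
Proof.
elim: n => [|n IHn]; apply/funext; first by case=> //= l; rewrite mulr0.
rewrite [value _](value_Node Leaf (spine n) Leaf) IHn.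
case=> [|[|l]|[|l]|[|i] [|j]]; rewrite /= ?/cross /= ?mulr0 ?mul0r ?addr0 ?add0r ?mul1r ?mulr1 ?oppr0 //.
- by case: n {IHn} => [|n]; rewrite /= ?mulr1 ?mulr0 ?addr0 ?add0r ?eqSS //.
- by case: n {IHn} => [|n]; rewrite ?exprS /= ?eqSS; ring.
Qed.

Lemma value_fork_Psi i j : (1 < i + j)%N ->
  value (Node Leaf (spine i) (spine j)) (Psi (i + j).+1)
  = - ((j == 0%N)%:R * (-1) ^+ i).
Proof.
move=> ij; rewrite value_Node !value_spine /= /cross.
have -> : (i + j == 0)%N = false by lia.
rewrite mul1r mulr0 mul0r !addr0; congr (- _).
case: j ij => [|j] ij; last by rewrite !mul0r.
by rewrite addn0 !eqxx andbT (_ : (0 < i)%N) ?mulr1 //; lia.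
Qed.

Lemma value_fork_Phi i j : (1 < i + j)%N ->
  value (Node Leaf (spine i) (spine j)) (Phi (i + j).+1)
  = (j == 0%N)%:R + (i == 0%N)%:R * (-1) ^+ j.
Proof.
move=> ij; rewrite value_Node !value_spine /= /cross mul1r.
have -> : (i + j == 0)%N = false by lia.
rewrite mul0r addr0 addrC; congr (_ + _).
  case: j ij => [|j] ij; last by rewrite !mul0r.
  by rewrite addn0 !eqxx andbT (_ : (0 < i)%N) ?mulr1 //; lia.
case: i ij => [|i] ij; last by rewrite !mul0r.
by rewrite add0n !eqxx andbT (_ : (0 < j)%N) ?mulr1 //; lia.
Qed.

Lemma value_fork_Chi i j a b :
  value (Node Leaf (spine i) (spine j)) (Chi a.+1 b)
  = (-1) ^+ i * ((i == a) && (j == b) && (0 < j)%N)%:R.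
Proof.
rewrite value_Node !value_spine /= /cross /= !mul1r mulr0 addr0.
rewrite [X in _ + X](_ : _ = 0) ?addr0; last by case: b => // b; rewrite mul0r.
rewrite [b == j]eq_sym [a == i]eq_sym.
case: (eqVneq j b) => [->|_]; last by rewrite !andbF !mulr0.
case: (0 < b)%N; last by rewrite !andbF !mulr0.
rewrite mulr1 !andbT; case: i => [|i] /=.
  by rewrite mulr0 add0r expr0 mul1r mulr1 eq_sym.
by rewrite mulr0 addr0.
Qed.

Lemma value_extra_Psi n : value (Node (spine 1) (spine n.+1) Leaf) (Psi n.+3) = 0.
Proof. by rewrite value_Node !value_spine /= /cross /= !mul0r !addr0 mulr0 oppr0. Qed.

Lemma value_extra_Phi n : value (Node (spine 1) (spine n.+1) Leaf) (Phi n.+3) = 0.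
Proof. by rewrite value_Node !value_spine /= mul0r. Qed.

Lemma value_extra_Chi n a : value (Node (spine 1) (spine n.+1) Leaf) (Chi a.+1 n.+2)
  = - (a == 0%N)%:R.
Proof.
rewrite value_Node !value_spine /= /cross /= eqSS eqxx.
by rewrite !mul0r !mulr0 !addr0 !add0r !mulr1 expr1 mulN1r.
Qed.

(** The values form a triangular system.  In weight k, only [x s_(k-1) x] has a
    nonzero coefficient psi_k; besides it only [x x s_(k-1)] contributes to
    phi_k; the coefficient of s^(i+1) t^(k-1-i) in chi with 0 < i < k - 1
    isolates [x s_i s_(k-1-i)]; and the coefficient of s t^(k-1) then detects
    [s_1 s_(k-2) x]. *)
Lemma ideal_normal_free k (c : 'I_k.+1 -> F) : (3 <= k)%N ->
  \sum_i c i *: (normal_vecs F k)`_i \in ideal_gen (alpha F) (2 * k + 1) ->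
  forall i, c i = 0.
Proof.
case: k c => [|[|[|n]]] // c _ Ic.
pose d i := c (inord i).
have cd i : c i = d i by rewrite /d inord_val.
have value_sum t : \sum_(i < n.+4) d i * value (normal_form n.+3 i) t = 0.
  have := congr1 (@^~ t) (ideal_gen_eval (fun=> generator) Ic).
  have vlin : linear (@eval_vec F (2 * n.+3 + 1) ^~ (fun=> generator)).
    by move=> x u v; exact: eval_vec_linear.
  rewrite (linear_fun_sum _ _ _ vlin) fct_sumE => E; rewrite -[RHS]E.
  apply: eq_bigr => i _; rewrite -cd nth_mktuple eval_tree_vec //.
  rewrite arity_weight /normal_form; case: i => i /= lti.
  by case: ltnP => ? /=; rewrite !weight_spine; lia.
have isolate t j : (j < n.+4)%N ->
    (forall i, (i < n.+4)%N -> i != j -> d i * value (normal_form n.+3 i) t = 0) ->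
    value (normal_form n.+3 j) t != 0 -> d j = 0.
  move=> ltj d0 /negPf nz; have /eqP := value_sum t.
  rewrite (bigD1 (Ordinal ltj)) //= big1 => [|i]; last by rewrite -val_eqE => /= /d0->.
  by rewrite addr0 mulf_eq0 nz orbF => /eqP.
have nf_fork i : (i < n.+3)%N ->
    normal_form n.+3 i = Node Leaf (spine i) (spine (n.+2 - i)).
  by rewrite /normal_form => ->.
have nf_extra : normal_form n.+3 n.+3 = Node (spine 1) (spine n.+1) Leaf.
  by rewrite /normal_form ltnn.
have sgn m : (-1) ^+ m != 0 :> F by rewrite signr_eq0.
have dlast : d n.+2 = 0.
  apply: (isolate (Psi n.+3)) => // [i|].
    rewrite ltnS leq_eqVlt => /orP[/eqP->|lti] ni.
      by rewrite nf_extra value_extra_Psi mulr0.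
    rewrite nf_fork // -[X in Psi X.+1](@subnKC i) //.
    rewrite value_fork_Psi; last by rewrite subnKC.
    by rewrite subn_eq0 leqNgt (_ : (i < n.+2)%N) ?mul0r ?oppr0 ?mulr0 //; lia.
  rewrite nf_fork // subnn -[X in Psi X.+1]addn0 value_fork_Psi ?addn0 //.
  by rewrite mul1r oppr_eq0.
have dmid i : (0 < i < n.+2)%N -> d i = 0.
  move=> ilt; apply: (isolate (Chi i.+1 (n.+2 - i))); first lia.
    move=> l; rewrite ltnS leq_eqVlt => /orP[/eqP->|ltl] nl.
      rewrite nf_extra value_Node !value_spine /= mulr0 add0r.
      by case: (n.+2 - i)%N => [|m]; rewrite ?mulr0 // eqSS (_ : (i == 0)%N = false) ?mulr0 ?mul0r ?mulr0 //; lia.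
    by rewrite nf_fork // value_fork_Chi (negPf nl) mulr0 mulr0.
  rewrite nf_fork ?value_fork_Chi; last lia.
  by rewrite !eqxx (_ : (0 < _ - _)%N) ?mulr1 //; lia.
have dfirst : d 0%N = 0.
  apply: (isolate (Phi n.+3)) => // [i|].
    rewrite ltnS leq_eqVlt => /orP[/eqP->|lti] ni.
      by rewrite nf_extra value_extra_Phi mulr0.
    have [->|ni2] := eqVneq i n.+2; first by rewrite dlast mul0r.
    by rewrite dmid ?mul0r //; lia.
  by rewrite nf_fork // (@value_fork_Phi 0 n.+2) //= mul1r add0r.
have dextra : d n.+3 = 0.
  apply: (isolate (Chi 1 n.+2)) => // [i|].
    move=> lti ni; have [->|ni2] := eqVneq i n.+2; first by rewrite dlast mul0r.
    have [->|ni0] := eqVneq i 0%N; first by rewrite dfirst mul0r.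
    by rewrite dmid ?mul0r //; lia.
  by rewrite nf_extra value_extra_Chi oppr_eq0 oner_eq0.
move=> i; rewrite cd; have := ltn_ord i; move: (val i) => j ltj.
have [->//|nj0] := eqVneq j 0%N; have [->//|nj2] := eqVneq j n.+2.
have [->//|nj3] := eqVneq j n.+3; apply: dmid; lia.
Qed.

End Independence.

Theorem theorem3p11 (F : fieldType) (charF0 : [pchar F] =i pred0)
    (k : nat) (hk : (3 <= k)%N) :
  \dim {:TPA F (2 * k + 1)} = k.+1.
Proof.
rewrite dim_quotv -(@ideal_normal_full F charF0 k hk).
set U := ideal_gen _ _; set X := normal_vecs F k.
have indep := fun c => @ideal_normal_free F k c hk.
have freeX : free X.
  by apply/freeP=> c c0; apply: indep; rewrite c0 mem0v.
rewrite dimv_disjoint_sum; last first.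
  apply/eqP; rewrite -subv0; apply/subvP=> x; rewrite memv_cap memv0 => /andP[Ux].
  move/coord_span=> xE; rewrite xE big1 // => i _.
  rewrite (indep (fun i => coord X i x)) ?scale0r //; first by rewrite -xE.
by rewrite addKn (eqP freeX) size_tuple.
Qed.
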